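(* Let $a,\delta$ be positive integers with $a<\delta<2a$ and $\gcd(a,\delta)=1$, and put $b=a+\delta$. Consider the subtraction game with subtraction set $S=\{a,b,a+b\}$. For $n\ge 0$ let $w_n = n + a\lfloor n/a\rfloor + b\lfloor n/\delta\rfloor$, and let $\mathcal W_0=\{w_n : n\ge 0\}$, $\mathcal W_1=\mathcal W_0+a$, $\mathcal W_2=\mathcal W_0-b$, $\mathcal W_3=(\mathcal W_0-\delta)\setminus\mathcal W_0$. Then $\mathcal W_0,\mathcal W_1,\mathcal W_2,\mathcal W_3$ are pairwise disjoint with union $\mathbb{N}=\{0,1,2,\dots\}$, and for each $i\in\{0,1,2,3\}$, $\mathcal W_i$ is precisely the set of positions (heap sizes) of nim-value $i$.
   Context: The subtraction game with subtraction set $S$: a position is a heap size $x\in\mathbb N$; a move from $x$ goes to $x-s$ for some $s\in S$ with $x-s\ge 0$. The nim-value (Sprague–Grundy value) of $x$ is defined recursively as the smallest non-negative integer not equal to the nim-value of any option $x-s$ ($s\in S$, $s\le x$). For $X\subseteq\mathbb N$ and $y\in\mathbb N$: $X+y=\{x+y : x\in X\}$ and $X-y=\{x-y : x\in X,\ x\ge y\}$ (only non-negative results are kept). *)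

(* Defs.v *)
From mathcomp Require Import all_boot.
From mathcomp Require Import boolp classical_sets.

Set Implicit Arguments.
Unset Strict Implicit.
Unset Printing Implicit Defensive.

Local Open Scope nat_scope.
Local Open Scope classical_set_scope.

Lemma mex_exists (s : seq nat) : exists n, n \notin s.
Proof.
exists (\max_(i <- s) i).+1; apply/negP => s_max.
by have := @leq_bigmax_seq _ s xpredT id _ s_max isT; rewrite ltnn.
Qed.

Definition mex (s : seq nat) : nat := ex_minn (mex_exists s).

Definition options (S : seq nat) (x : nat) : seq nat :=
  [seq x - s | s <- S & s <= x].

(* The first argument of nimval_rec is fuel; when 0 \notin S, x.+1 units
   suffice at position x, and nimvalE below is then the defining recursion. *)
Fixpoint nimval_rec (k : nat) (S : seq nat) (x : nat) : nat :=
  if k is k'.+1 then mex [seq nimval_rec k' S y | y <- options S x] else 0.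

Definition nimval (S : seq nat) (x : nat) : nat := nimval_rec x.+1 S x.

Lemma options_lt (S : seq nat) (x y : nat) :
  0 \notin S -> y \in options S x -> y < x.
Proof.
move=> S0 /mapP[s]; rewrite mem_filter => /andP[lesx sS] ->.
have s_gt0 : 0 < s by rewrite lt0n; apply: contraNneq S0 => <-.
by rewrite ltn_subrL s_gt0 (leq_trans s_gt0 lesx).
Qed.

Lemma nimval_rec_fuel (S : seq nat) (k x : nat) :
  0 \notin S -> x < k -> nimval_rec k S x = nimval S x.
Proof.
move=> S0; rewrite /nimval; move: {2}x (leqnn x) => n.
elim: n k x => [|n IHn] [|k] x // lexn ltxk /=; congr mex;
  apply/eq_in_map => y /(options_lt S0) ltyx.
  by move: lexn ltyx; rewrite leqn0 => /eqP ->.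
have leyn : y <= n by rewrite -ltnS (leq_trans ltyx).
have ltyk : y < k by apply: leq_trans ltyx _.
by rewrite (IHn k y leyn ltyk) -(IHn x y leyn ltyx).
Qed.

Lemma nimvalE (S : seq nat) (x : nat) : 0 \notin S ->
  nimval S x = mex [seq nimval S y | y <- options S x].
Proof.
move=> S0; rewrite {1}/nimval /=; congr mex.
by apply/eq_in_map => y /(options_lt S0) /nimval_rec_fuel ->.
Qed.

Definition shift_up (X : set nat) (y : nat) : set nat :=
  [set x + y | x in X].

Definition shift_down (X : set nat) (y : nat) : set nat :=
  [set x - y | x in [set x | X x /\ y <= x]].

Definition w (a b delta n : nat) : nat :=
  n + a * (n %/ a) + b * (n %/ delta).

Definition W0 (a b delta : nat) : set nat := range (w a b delta).

Definition W (a b delta : nat) (i : 'I_4) : set nat :=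
  match val i with
  | 0 => W0 a b delta
  | 1 => shift_up (W0 a b delta) a
  | 2 => shift_down (W0 a b delta) b
  | _ => shift_down (W0 a b delta) delta `\` W0 a b delta
  end.

(* Main.v *)
(** The proof rests on two properties of [W0]: no two of its elements differ by
    [a], [b] or [a + b], and every [x] satisfies [x], [x - a], [x + b] or
    [x + delta] in [W0].  The first makes each [W i] free of moves, since each
    is contained in a translate of [W0].  The second, applied to [x - b], shows
    that every [x] outside [W0] has an option in [W0]; applied to [x - a], this
    gives an option in [W0 + a] whenever [x] is outside [W0] and [W0 + a].
    Finally the move by [a] leads from [W0 - delta] into [W0 - b]. *)
Require Import Defs.
From mathcomp Require Import all_boot.
From mathcomp Require Import boolp classical_sets.
From mathcomp Require Import zify.

Local Open Scope nat_scope.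
Local Open Scope classical_set_scope.

Lemma mex_eq (s : seq nat) (n : nat) :
  n \notin s -> (forall j, j < n -> j \in s) -> mex s = n.
Proof.
move=> ns lt_s; rewrite /mex; case: ex_minnP => m ms m_min.
apply/eqP; rewrite eqn_leq m_min //= leqNgt; apply/negP => /lt_s.
by rewrite (negbTE ms).
Qed.

Lemma mem_options (S : seq nat) (x y : nat) :
  reflect (exists2 s, s \in S & x = y + s) (y \in options S x).
Proof.
apply: (iffP mapP) => [[s]|[s sS ->]].
  by rewrite mem_filter => /andP[lesx sS] ->; exists s; rewrite ?subnK.
by exists s; rewrite ?addnK // mem_filter sS leq_addl.
Qed.

(** By strong induction on [x]: moves never stay inside a class and reach every class of smaller
    index, so the mex over the options of [x] is the index of its class. Disjointness of the classes
    comes out of the conclusion. *)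
Lemma nimval_classes (S : seq nat) (k : nat) (P : 'I_k -> set nat) :
    0 \notin S ->
    (forall x, exists i, P i x) ->
    (forall i y s, s \in S -> P i y -> ~ P i (y + s)) ->
    (forall (i j : 'I_k) x, P i x -> j < i ->
       exists y s, [/\ s \in S, x = y + s & P j y]) ->
  forall i, P i = [set x | nimval S x = i].
Proof.
move=> S0 P_cover P_free P_reach.
have P_nim x : forall i, P i x -> nimval S x = i.
  elim/ltn_ind: x => x IH i Pix; rewrite nimvalE //; apply: mex_eq.
    apply/negP => /mapP[y y_opt i_y]; have [j Pjy] := P_cover y.
    have eq_ij : i = j.
      by apply: val_inj; rewrite /= i_y (IH _ (options_lt S0 y_opt) j).
    have /mem_options[s sS xE] := y_opt.
    by apply: (P_free i y s sS); rewrite -?xE // eq_ij.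
  move=> j lt_ji; have ltjk := ltn_trans lt_ji (ltn_ord i).
  have [y [s [sS xE Pjy]]] := P_reach i (Ordinal ltjk) x Pix lt_ji.
  have y_opt : y \in options S x by apply/mem_options; exists s.
  by apply/mapP; exists y => //; rewrite (IH _ (options_lt S0 y_opt) _ Pjy).
move=> i; apply/seteqP; split=> x /=; first exact: P_nim.
by have [j Pjx] := P_cover x; rewrite (P_nim _ _ Pjx) => /val_inj <-.
Qed.

Lemma shift_upE (X : set nat) (x y : nat) :
  shift_up X y x <-> exists2 z, X z & x = z + y.
Proof. by split=> -[z Xz zE]; exists z. Qed.

Lemma shift_downE (X : set nat) (x y : nat) : shift_down X y x <-> X (x + y).
Proof.
split=> [[z [Xz leyz] <-]|Xxy]; first by rewrite subnK.
exists (x + y); last exact: addnK.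
by split=> //; apply: leq_addl.
Qed.

Section W0Theory.

Variables a d : nat.
Local Notation W0 := (W0 a (a + d) d).

(** Naming the quotients [p] and [q] through bounds on [n] turns divisions into inequalities suited
    to [lia] and [nia]. *)
Lemma wE (n p q : nat) : a * p <= n < a * p + a -> d * q <= n < d * q + d ->
  w a (a + d) d n = n + a * p + (a + d) * q.
Proof.
move=> hp hq; rewrite /w.
have divE c r : c * r <= n < c * r + c -> n %/ c = r by nia.
by rewrite (divE _ _ hp) (divE _ _ hq).
Qed.

Lemma mem_W0 (x n p q : nat) :
    a * p <= n < a * p + a -> d * q <= n < d * q + d ->
  x = n + a * p + (a + d) * q -> W0 x.
Proof. by move=> hp hq ->; exists n => //; apply: wE. Qed.

Lemma W0P (x : nat) : 0 < a -> 0 < d -> W0 x -> exists n p q,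
  [/\ a * p <= n < a * p + a, d * q <= n < d * q + d
    & x = n + a * p + (a + d) * q].
Proof.
move=> a_gt0 d_gt0 [n _ <-]; exists n, (n %/ a), (n %/ d); split=> //.
- have := divn_eq n a; have := ltn_pmod n a_gt0; lia.
- have := divn_eq n d; have := ltn_pmod n d_gt0; lia.
Qed.

Hypotheses (a_gt0 : 0 < a) (lt_ad : a < d) (lt_d2a : d < 2 * a).

Lemma lt_W0 (x : nat) : x < a -> W0 x.
Proof. by move=> lt_xa; apply: (mem_W0 _ x 0 0); lia. Qed.

(** As [w] is strictly increasing, [s = (n' - n) + a * u + (a + d) * v] with [n < n'], where [u] and
    [v] count the multiples of [a] and of [d] in [(n, n']]. No length [n' - n] fits these counts. *)
Lemma W0_sub_free (y s : nat) :
  s \in [:: a; a + d; a + (a + d)] -> W0 y -> ~ W0 (y + s).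
Proof.
have d_gt0 : 0 < d by lia.
rewrite !inE => s_eq /(W0P _ a_gt0 d_gt0)[n [p [q [hp hq yE]]]].
move=> /(W0P _ a_gt0 d_gt0)[n' [p' [q' [hp' hq' ysE]]]].
have lt_nn' : n < n'.
  rewrite ltnNge; apply/negP => le_n'n.
  have le_p : p' <= p by nia.
  have le_q : q' <= q by nia.
  have : a * p' <= a * p by rewrite leq_mul2l le_p orbT.
  have : (a + d) * q' <= (a + d) * q by rewrite leq_mul2l le_q orbT.
  by case/or3P: s_eq => /eqP; lia.
have [u p'E] : exists u, p' = p + u by exists (p' - p); nia.
have [v q'E] : exists v, q' = q + v by exists (q' - q); nia.
subst p' q'.
have {yE ysE} sE : s + n = n' + a * u + (a + d) * v by lia.
(* Size forces [v < 2], and [u < 4] because [d < 2 * a]. A typical clash: [v = 0] and [s = a + d]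
   give [n' - n < d], hence [u >= 2]; but then [n' - n <= d - a < a], too short for two multiples of
   [a]. *)
case: v => [|[|v]] in hq' sE; last by case/or3P: s_eq => /eqP; nia.
- by case: u => [|[|[|[|u]]]] in hp' sE; case/or3P: s_eq => /eqP; nia.
- by case: u => [|[|u]] in hp' sE; case/or3P: s_eq => /eqP; nia.
Qed.

(* Write [x = w_m - i] with [m] least such that [x <= w_m].  If [i > 0], then
   [x] lies in the gap of [W0] below [w_m], so [a] or [d] divides [m]. *)
Lemma W0_cover (x : nat) :
  [\/ W0 x, exists2 z, W0 z & x = z + a, W0 (x + (a + d)) | W0 (x + d)].
Proof.
have d_gt0 : 0 < d by lia.
have ex_m : exists m, x <= w a (a + d) d m.
  by exists x; rewrite /w -addnA leq_addr.
case: (ex_minnP ex_m) => m le_xm m_min.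
have lt_x k : k < m -> w a (a + d) d k < x.
  by move=> lt_km; rewrite ltnNge; apply/negP => /m_min; lia.
have hp : a * (m %/ a) <= m < a * (m %/ a) + a.
  by have := divn_eq m a; have := ltn_pmod m a_gt0; lia.
have hq : d * (m %/ d) <= m < d * (m %/ d) + d.
  by have := divn_eq m d; have := ltn_pmod m d_gt0; lia.
move: (m %/ a) (m %/ d) hp hq => p q hp hq.
rewrite (wE _ _ _ hp hq) in le_xm.
have [xE|ne_x] := eqVneq x (m + a * p + (a + d) * q).
  by apply: Or41; apply: (mem_W0 _ m p q).
have m_gt0 : 0 < m.
  rewrite lt0n; apply/eqP => m0; subst m.
  have p0 : p = 0 by nia.
  have q0 : q = 0 by nia.
  by subst p q; lia.
(* The jump from [w_(m-1)] to [w_m] bounds [i]: by [a] if only [a] divides [m], by [a + d] if only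
   [d] does, by [2 * a + d] if both do. *)
have /lt_x : m.-1 < m by lia.
have [mp|ne_mp] := eqVneq m (a * p); have [mq|ne_mq] := eqVneq m (d * q).
(* The index [m + (d - i)] yields [x + d] if no multiple of [a] or [d] is passed after [m]; passing
   one multiple of [a] adds [a] and yields [x + (a + d)] instead. Indices below [m] serve for
   [x - a]. *)
- case: p mp => [|p] mp in hp le_xm ne_x *; first by lia.
  case: q mq => [|q] mq in hq le_xm ne_x *; first by lia.
  rewrite (wE _ p q); [|lia..] => lt_x1.
  set i := m + a * p.+1 + (a + d) * q.+1 - x.
  have [le_id|lt_di] := leqP i d.
    have [lt_a|le_a] := ltnP (d - i) a.
      by apply: Or44; apply: (mem_W0 _ (m + (d - i)) p.+1 q.+1); lia.
    by apply: Or43; apply: (mem_W0 _ (m + (d - i)) p.+2 q.+1); lia.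
  have [le_ib|lt_bi] := leqP i (a + d).
    by apply: Or43; apply: (mem_W0 _ (m + (a + d - i)) p.+1 q.+1); lia.
  apply: Or42; exists (x - a); last by lia.
  by apply: (mem_W0 _ (m - (i - (a + d))) p q); lia.
- case: p mp => [|p] mp in hp le_xm ne_x *; first by lia.
  rewrite (wE _ p q); [|lia..] => lt_x1.
  set i := m + a * p.+1 + (a + d) * q - x.
  have [le_q|lt_q] := leqP (d * q) (m - i).
    apply: Or42; exists (x - a); last by lia.
    by apply: (mem_W0 _ (m - i) p q); lia.
  have [lt_a|le_a] := ltnP (d - i) a.
    by apply: Or44; apply: (mem_W0 _ (m + (d - i)) p.+1 q); lia.
  by apply: Or43; apply: (mem_W0 _ (m + (d - i)) p.+2 q); lia.
- case: q mq => [|q] mq in hq le_xm ne_x *; first by lia.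
  rewrite (wE _ p q); [|lia..] => lt_x1.
  set i := m + a * p + (a + d) * q.+1 - x.
  have [le_id|lt_di] := leqP i d.
    have [lt1|le1] := ltnP (m + (d - i)) (a * p.+1).
      by apply: Or44; apply: (mem_W0 _ (m + (d - i)) p q.+1); lia.
    have [lt2|le2] := ltnP (m + (d - i)) (a * p.+2).
      by apply: Or43; apply: (mem_W0 _ (m + (d - i)) p.+1 q.+1); lia.
    (* Here two multiples of [a] are passed; stepping the index back by [a] leaves one, whose jump
       restores the lost [a]. *)
    by apply: Or44; apply: (mem_W0 _ (m + (d - i) - a) p.+1 q.+1); lia.
  have [lt1|le1] := ltnP (m + (a + d - i)) (a * p.+1).
    by apply: Or43; apply: (mem_W0 _ (m + (a + d - i)) p q.+1); lia.
  apply: Or42; exists (x - a); last by lia.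
  by apply: (mem_W0 _ (m - (i - d)) p q); lia.
- by rewrite (wE _ p q); lia.
Qed.

(** For [x >= a + d], the cover of [x - (a + d)] supplies the move, its last case being the move by
    [a]. Below [a + d], [W0] consists of [[0, a)] and [[2 * a, a + d)]. *)
Lemma W0_absorbing (x : nat) : ~ W0 x ->
  exists y s, [/\ s \in [:: a; a + d; a + (a + d)], x = y + s & W0 y].
Proof.
move=> nW0x; have [lt_xa|le_ax] := ltnP x a.
  by case: nW0x; apply: lt_W0.
have [lt_x2a|le_2ax] := ltnP x (2 * a).
  exists (x - a), a; split; rewrite ?inE ?eqxx //; first by lia.
  by apply: (mem_W0 _ (x - a) 0 0); lia.
have [lt_xb|le_bx] := ltnP x (a + d).
  by case: nW0x; apply: (mem_W0 _ (x - a) 1 0); lia.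
case: (W0_cover (x - (a + d))) => [W0y|[z W0z zE]|W0y|W0y].
- by exists (x - (a + d)), (a + d); split; rewrite ?inE ?eqxx ?orbT ?subnK.
- by exists z, (a + (a + d)); split; rewrite ?inE ?eqxx ?orbT //; lia.
- by case: nW0x; rewrite subnK in W0y.
- exists (x - a), a; split; rewrite ?inE ?eqxx //; first by lia.
  by have -> : x - a = x - (a + d) + d by lia.
Qed.

(* [x - a] has an option [y] in [W0]; making the same move from [x] leads to
   [y + a]. *)
Lemma W1_absorbing (x : nat) : ~ W0 x -> (forall z, W0 z -> x <> z + a) ->
  exists y s, [/\ s \in [:: a; a + d; a + (a + d)], x = y + a + s & W0 y].
Proof.
move=> nW0x nW1x; have [lt_xa|le_ax] := ltnP x a.
  by case: nW0x; apply: lt_W0.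
have nW0xa : ~ W0 (x - a) by move=> /nW1x; lia.
have [y [s [sS xE W0y]]] := W0_absorbing _ nW0xa.
by exists y, s; split=> //; lia.
Qed.

End W0Theory.

Theorem mainTheorem1 (a delta : nat) :
  0 < a -> 0 < delta -> a < delta -> delta < 2 * a -> gcdn a delta = 1 ->
  let b := a + delta in
  let S := [:: a; b; a + b] in
  [/\ trivIset [set: 'I_4] (W a b delta),
      \bigcup_(i in [set: 'I_4]) W a b delta i = [set: nat]
    & forall i : 'I_4, W a b delta i = [set x | nimval S x = i]].
Proof.
move=> a_gt0 _ lt_ad lt_d2a _ b S.
have W_cover x : exists i, W a b delta i x.
  have [W0x|nW0x] := pselect (W0 a b delta x).
    by exists (inord 0); rewrite /W /= inordK.
  have [//|[z W0z xE]|W0xb|W0xd] := W0_cover _ _ a_gt0 lt_ad lt_d2a x.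
  - by exists (inord 1); rewrite /W /= inordK //; apply/shift_upE; exists z.
  - by exists (inord 2); rewrite /W /= inordK //; apply/shift_downE.
  - by exists (inord 3); rewrite /W /= inordK //; split=> //; apply/shift_downE.
have free := W0_sub_free _ _ a_gt0 lt_ad lt_d2a.
have W_class : forall i, W a b delta i = [set x | nimval S x = i].
  apply: nimval_classes => //.
  - by rewrite !inE; lia.
  - move=> [[|[|[|[|//]]]] lti] y s sS; rewrite /W /=.
    + exact: free.
    + move=> /shift_upE[z W0z ->] /shift_upE[z' W0z' zE].
      by apply: (free z s sS W0z); have -> : z + s = z' by lia.
    + move=> /shift_downE W0y /shift_downE W0ys.
      by apply: (free _ s sS W0y); rewrite addnAC.
    + move=> [/shift_downE W0y _] [/shift_downE W0ys _].
      by apply: (free _ s sS W0y); rewrite addnAC.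
  - move=> i j x Wix lt_ji.
    have nW0x : 0 < i -> ~ W0 a b delta x.
      case: i Wix {lt_ji} => [[|[|[|[|//]]]] lti] //;
        rewrite /W /= => Wx _ W0x.
      + move/shift_upE: Wx => [z W0z xE].
        by apply: (free z a _ W0z); rewrite -?xE // !inE eqxx.
      + by move/shift_downE: Wx; apply: free => //; rewrite !inE eqxx orbT.
      + by case: Wx.
    (* If [x = z + a], then [x + b = z + (a + b)] and [x + delta = z + b], which [free] keeps out of
       [W0]. *)
    have nW1x : 1 < i -> forall z, W0 a b delta z -> x <> z + a.
      case: i Wix {lt_ji nW0x} => [[|[|[|[|//]]]] lti] //;
        rewrite /W /= => Wx _ z W0z xE.
      + move/shift_downE: Wx; rewrite xE -addnA; apply: free W0z.
        by rewrite !inE eqxx !orbT.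
      + case: Wx => /shift_downE + _; rewrite xE -addnA; apply: free W0z.
        by rewrite !inE eqxx !orbT.
    have lt_j3 : j < 3 by have := ltn_ord i; lia.
    case: j lt_ji lt_j3 => [[|[|[|//]]] ltj] /= lt_ji _; rewrite /W /=.
    + exact: W0_absorbing (nW0x lt_ji).
    + have [||y [s [sS xE W0y]]] := W1_absorbing _ _ a_gt0 lt_ad lt_d2a x.
      * by apply: nW0x; lia.
      * exact: nW1x.
      * by exists (y + a), s; split=> //; apply/shift_upE; exists y.
    + case: i Wix lt_ji nW0x {nW1x} => [[|[|[|[|//]]]] lti] //;
        rewrite /W /= => [[/shift_downE W0xd _]] _ nW0x.
      have [lt_xa|le_ax] := ltnP x a.
        by case: nW0x => //; apply: lt_W0.
      (* The target is in class 2 because [(x - a) + b = x + delta]. *)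
      exists (x - a), a; split; rewrite ?inE ?eqxx ?subnK //.
      by apply/shift_downE; rewrite /b addnA subnK.
split=> //.
  by move=> i j _ _ [x []]; rewrite !W_class /= => -> /val_inj.
by apply/seteqP; split=> // x _; have [i Wix] := W_cover x; exists i.
Qed.
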